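(* (Weak duality) Let $x\in S$ and $(u,\tau,\lambda)\in Y$. If the matrix $F(\tau,u)=\sum_{i=1}^m\tau_i\big[A_i-\frac{f_i(u)}{g_i(u)}B_i\big]$ is positive semidefinite and $h_j$ is convex for each $j\in J$, then it is not the case that $\frac{f_i(x)}{g_i(x)}\le\frac{f_i(u)}{g_i(u)}$ for all $i\in I$ with strict inequality for at least one $i\in I$.
   Context: Setting. Let $m,\ell,n\ge 1$, $I=\{1,\dots,m\}$, $J=\{1,\dots,\ell\}$, and let $\Omega\subseteq\mathbb{R}^n$ be open. For $i\in I$ and $x\in\mathbb{R}^n$ let $f_i(x)=x^TA_ix+a_i^Tx+\bar a_i$ and $g_i(x)=x^TB_ix+b_i^Tx+\bar b_i$, where $A_i,B_i\in\mathbb{R}^{n\times n}$ are symmetric, $B_i$ is positive semidefinite, $a_i,b_i\in\mathbb{R}^n$, $\bar a_i,\bar b_i\in\mathbb{R}$; the system $2B_ix+b_i=0$ is assumed to have a solution $w^i$, and $\bar b_i>-((w^i)^TB_iw^i+b_i^Tw^i)$, so that $g_i(x)>0$ for all $x\in\mathbb{R}^n$. The functions $h_j:\Omega\to\mathbb{R}$, $j\in J$, are continuously differentiable. The feasible set is $S=\{x\in\Omega: h_j(x)\le 0\ \forall j\in J\}$. The primal problem (VQFP) is to minimize (in the Pareto sense) $\big(\frac{f_1(x)}{g_1(x)},\dots,\frac{f_m(x)}{g_m(x)}\big)$ over $x\in S$. The dual problem (VQFD) is to maximize $\big(\frac{f_1(u)}{g_1(u)},\dots,\frac{f_m(u)}{g_m(u)}\big)$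 over $(u,\tau,\lambda)\in Y$, where $Y$ is the set of all $(u,\tau,\lambda)\in S\times\mathbb{R}^m\times\mathbb{R}^\ell$ such that $$\sum_{i=1}^m\tau_i\Big(\nabla f_i(u)-\frac{f_i(u)}{g_i(u)}\nabla g_i(u)\Big)+\sum_{j=1}^\ell\lambda_j\nabla h_j(u)=0,\quad \sum_{j=1}^\ell\lambda_jh_j(u)\ge0,\quad \tau_i>0\ \forall i,\quad \lambda_j\ge0\ \forall j,\quad \sum_{j=1}^\ell\lambda_j=1.$$ Convexity of a differentiable function $h:\Omega\to\mathbb{R}$: $\Omega$ is convex and $h(x)-h(y)\ge\nabla h(y)^T(x-y)$ for all $x,y\in\Omega$. *)

(* Defs.v *)
From HB Require Import structures.
From mathcomp Require Import all_boot all_order all_algebra.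
From mathcomp Require Import all_classical all_reals all_analysis.

Set Implicit Arguments.
Unset Strict Implicit.
Unset Printing Implicit Defensive.

Import Order.TTheory GRing.Theory Num.Theory.
Import numFieldNormedType.Exports.

Local Open Scope classical_set_scope.
Local Open Scope ring_scope.

Definition quadfun (R : realType) (n : nat) (M : 'M[R]_n) (c : 'cV[R]_n)
    (d : R) (x : 'cV[R]_n) : R :=
  (x^T *m M *m x) ord0 ord0 + (c^T *m x) ord0 ord0 + d.

(* Symmetry is not part of this predicate; the matrices it is applied to are
   assumed symmetric, or are linear combinations of such matrices. *)
Definition psdmx (R : realType) (n : nat) (M : 'M[R]_n) : Prop :=
  forall x : 'cV[R]_n, 0 <= (x^T *m M *m x) ord0 ord0.

Definition grad (R : realType) (n : nat) (f : 'cV[R]_n -> R) (x : 'cV[R]_n) :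
    'cV[R]_n :=
  \col_k 'D_(delta_mx k ord0) f x.

(* A function on the open set Omega is represented by a total function; its
   differentiability and its gradient at points of Omega depend only on its
   values on Omega. *)
Definition continuously_differentiable_on (R : realType) (n : nat)
    (Omega : set 'cV[R]_n) (h : 'cV[R]_n -> R) : Prop :=
  (forall x, Omega x -> differentiable h x) /\
  {within Omega, continuous (grad h)}.

Definition convex_diff_on (R : realType) (n : nat) (Omega : set 'cV[R]_n)
    (h : 'cV[R]_n -> R) : Prop :=
  convex_set Omega /\
  forall x y, Omega x -> Omega y ->
    h x - h y >= ((grad h y)^T *m (x - y)) ord0 ord0.

Definition feasible (R : realType) (l n : nat) (Omega : set 'cV[R]_n)
    (h : 'I_l -> 'cV[R]_n -> R) : set 'cV[R]_n :=
  [set x | Omega x /\ forall j, h j x <= 0].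

Definition dual_feasible (R : realType) (m l n : nat) (Omega : set 'cV[R]_n)
    (f g : 'I_m -> 'cV[R]_n -> R) (h : 'I_l -> 'cV[R]_n -> R) :
    set ('cV[R]_n * 'cV[R]_m * 'cV[R]_l) :=
  [set p : 'cV[R]_n * 'cV[R]_m * 'cV[R]_l | let: (u, tau, lambda) := p in
    feasible Omega h u /\
    \sum_(i < m) tau i ord0 *:
        (grad (f i) u - (f i u / g i u) *: grad (g i) u)
      + \sum_(j < l) lambda j ord0 *: grad (h j) u = 0 /\
    0 <= \sum_(j < l) lambda j ord0 * h j u /\
    (forall i, 0 < tau i ord0) /\
    (forall j, 0 <= lambda j ord0) /\
    \sum_(j < l) lambda j ord0 = 1].

(* Main.v *)
(** With [r_i = f_i(u) / g_i(u)], the function [q = sum_i tau_i (f_i - r_i g_i)]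
    is quadratic with second-order part [F(tau, u)] and vanishes at [u].
    Positive semidefiniteness of [F], dual stationarity and the convexity of the
    [h_j] give
    [q(x) >= grad q(u)^T (x - u) = - sum_j lambda_j grad h_j(u)^T (x - u)
          >= sum_j lambda_j (h_j(u) - h_j(x)) >= 0],
    whereas dominance of [u] by [x] together with [tau > 0] and [g > 0] would
    make [q(x)] negative. *)
Require Import Defs.
From HB Require Import structures.
From mathcomp Require Import all_boot all_order all_algebra.
From mathcomp Require Import all_classical all_reals all_analysis.
From mathcomp Require Import ring.

Set Implicit Arguments.
Unset Strict Implicit.
Unset Printing Implicit Defensive.

Import Order.TTheory GRing.Theory Num.Theory.
Import numFieldNormedType.Exports.

Local Open Scope classical_set_scope.
Local Open Scope ring_scope.

(** Unlike [mxE], this rule and the next two leave matrix products folded, so that their entries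
    stay atoms for [ring]. *)
Lemma mxDE (V : nmodType) (p q : nat) (A B : 'M[V]_(p, q)) i j :
  (A + B) i j = A i j + B i j.
Proof. by rewrite mxE. Qed.

Lemma mxNE (V : zmodType) (p q : nat) (A : 'M[V]_(p, q)) i j :
  (- A) i j = - A i j.
Proof. by rewrite mxE. Qed.

Lemma mxZE (R : pzRingType) (p q : nat) (t : R) (A : 'M[R]_(p, q)) i j :
  (t *: A) i j = t * A i j.
Proof. by rewrite mxE. Qed.

(** Exact second-order Taylor expansion; symmetry of [M] merges the two cross terms. *)
Lemma quadfunD (R : realType) (n : nat) (M : 'M[R]_n) (c : 'cV[R]_n) (d : R)
    (x v : 'cV[R]_n) : M^T = M ->
  quadfun M c d (x + v) = quadfun M c d x
    + ((2 *: (M *m x) + c)^T *m v) ord0 ord0 + (v^T *m M *m v) ord0 ord0.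
Proof.
move=> Msym; rewrite /quadfun.
have -> : (x + v)^T *m M *m (x + v) = x^T *m M *m x
    + 2 *: ((M *m x)^T *m v) + v^T *m M *m v.
  (* The two sides are transposes of each other, and a 1 by 1 matrix equals its transpose. *)
  have vMx : v^T *m M *m x = (M *m x)^T *m v.
    have -> : (M *m x)^T *m v = (v^T *m M *m x)^T
      by rewrite !trmx_mul trmxK Msym mulmxA.
    by apply/matrixP=> i j; rewrite !ord1 [RHS]mxE.
  rewrite [(x + v)^T]linearD /= !(mulmxDl, mulmxDr) vMx trmx_mul Msym.
  by rewrite scaler_nat mulr2n !addrA.
rewrite [(_ + c)^T]linearD /= [(_ + c^T) *m v]mulmxDl.
rewrite linearZ /= -scalemxAl mulmxDr.
rewrite !mxDE !mxZE.
ring.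
Qed.

(** Expanding around [w] kills the linear term and leaves a nonnegative form in [x - w]. *)
Lemma quadfun_ge_critical (R : realType) (n : nat) (M : 'M[R]_n)
    (c : 'cV[R]_n) (d : R) (w x : 'cV[R]_n) :
  M^T = M -> psdmx M -> 2 *: (M *m w) + c = 0 ->
  quadfun M c d w <= quadfun M c d x.
Proof.
move=> Msym Mpsd w_crit; rewrite -[x in leRHS](subrK w) [_ - w + w]addrC.
rewrite quadfunD // w_crit trmx0 mul0mx.
by rewrite [_ ord0 ord0 in X in _ + X + _]mxE addr0 lerDl.
Qed.

(** By the expansion, the difference quotient along a basis vector [v] is [G k ord0 + t * s] for
    [t != 0], which is affine in [t]. *)
Lemma grad_quadfun (R : realType) (n : nat) (M : 'M[R]_n) (c : 'cV[R]_n)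
    (d : R) (x : 'cV[R]_n) : M^T = M ->
  grad (quadfun M c d) x = 2 *: (M *m x) + c.
Proof.
move=> Msym; apply/colP => k; rewrite [LHS]mxE.
set v := delta_mx k ord0; set s := (v^T *m M *m v) ord0 ord0.
set G := 2 *: (M *m x) + c.
have Gv : (G^T *m v) ord0 ord0 = G k ord0 by rewrite /v -colE !mxE.
rewrite /derive; apply: cvg_lim => //.
have lin : (fun t : R => G k ord0 + t * s) @ 0^' --> G k ord0.
  apply: cvg_within_filter.
  have : (fun t : R => G k ord0 + t * s) @ (0 : R) --> G k ord0 + 0 * s.
    by apply: cvgD; [exact: cvg_cst | apply: cvgMl; exact: cvg_id].
  by rewrite mul0r addr0.
apply: cvg_trans lin; apply: near_eq_cvg; near=> t.
have t0 : t != 0 by near: t; exact: nbhs_dnbhs_neq.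
rewrite /= [t *: v + x]addrC quadfunD // -/G [(t *: v)^T]linearZ /=.
rewrite -!(scalemxAl, scalemxAr) !mxZE Gv -/s /GRing.scale /=.
by field.
Unshelve. all: by end_near.
Qed.

Theorem theorem4p4 (R : realType) (m l n : nat)
    (m_ge1 : (1 <= m)%N) (l_ge1 : (1 <= l)%N) (n_ge1 : (1 <= n)%N)
    (Omega : set 'cV[R]_n) (Omega_open : open Omega)
    (A B : 'I_m -> 'M[R]_n) (a b : 'I_m -> 'cV[R]_n) (abar bbar : 'I_m -> R)
    (A_sym : forall i, (A i)^T = A i)
    (B_sym : forall i, (B i)^T = B i)
    (B_psd : forall i, psdmx (B i))
    (w : 'I_m -> 'cV[R]_n)
    (w_sol : forall i, 2 *: (B i *m w i) + b i = 0)
    (bbar_gt : forall i,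
      bbar i > - (((w i)^T *m B i *m w i) ord0 ord0
                  + ((b i)^T *m w i) ord0 ord0))
    (h : 'I_l -> 'cV[R]_n -> R)
    (h_C1 : forall j, continuously_differentiable_on Omega (h j))
    (f := fun i => quadfun (A i) (a i) (abar i))
    (g := fun i => quadfun (B i) (b i) (bbar i))
    (x u : 'cV[R]_n) (tau : 'cV[R]_m) (lambda : 'cV[R]_l)
    (x_feasible : feasible Omega h x)
    (y_feasible : dual_feasible Omega f g h (u, tau, lambda))
    (F_psd : psdmx (\sum_(i < m) tau i ord0 *: (A i - (f i u / g i u) *: B i)))
    (h_convex : forall j, convex_diff_on Omega (h j)) :
  ~ ((forall i, f i x / g i x <= f i u / g i u) /\
     (exists i, f i x / g i x < f i u / g i u)).
Proof.
have [Ox hx] := x_feasible.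
have [[Ou hu] [stat [lhu [tau0 [l0 _]]]]] := y_feasible.
(* The minimum of [g i] is attained at [w i], where [bbar_gt] makes it positive. *)
have g0 i y : 0 < g i y.
  apply: lt_le_trans
    (quadfun_ge_critical (bbar i) y (B_sym i) (B_psd i) (w_sol i)).
  by rewrite /quadfun -ltrBlDl sub0r; exact: bbar_gt.
pose r i := f i u / g i u.
pose D i := grad (f i) u - r i *: grad (g i) u.
pose dx := x - u.
have xE : x = u + dx by rewrite /dx addrC subrK.
have dxE : x - u = dx by [].
clearbody dx.
have expand i : f i x - r i * g i x =
    ((D i)^T *m dx) ord0 ord0 + (dx^T *m (A i - r i *: B i) *m dx) ord0 ord0.
  (* This cancels the constant term of the expansion at [u] and removes the division hidden in
     [r i]. *)
  have fu : f i u = r i * g i u by rewrite divfK ?gt_eqF.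
  have -> : D i = (2 *: (A i *m u) + a i) - r i *: (2 *: (B i *m u) + b i).
    by rewrite /D !grad_quadfun.
  rewrite xE /f /g !quadfunD // -/(f i u) -/(g i u) fu.
  rewrite [(_ - r i *: _)^T]linearB /= [(r i *: _)^T]linearZ /=.
  rewrite mulmxBr !mulmxBl -scalemxAr -!scalemxAl.
  rewrite !(mxDE, mxNE, mxZE).
  ring.
case=> dom [k sdom].
have : \sum_(i < m) tau i ord0 * (f i x - r i * g i x) < 0.
  (* The index [k] of strict improvement gives a negative term; the others are at most zero. *)
  rewrite [ltLHS](bigD1 k) //= ltr_wnDr //.
    apply: sumr_le0 => i _; rewrite pmulr_rle0 // subr_le0.
    by rewrite -ler_pdivrMr //; exact: dom.
  by rewrite pmulr_rlt0 // subr_lt0 -ltr_pdivrMr.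
apply/negP; rewrite -leNgt.
under eq_bigr do rewrite expand mulrDr.
rewrite big_split /=.
have -> : \sum_(i < m) tau i ord0 * ((D i)^T *m dx) ord0 ord0 =
    ((\sum_(i < m) tau i ord0 *: D i)^T *m dx) ord0 ord0.
  rewrite linear_sum /= mulmx_suml summxE; apply: eq_bigr => i _.
  by rewrite linearZ /= -scalemxAl mxZE.
have -> : \sum_(i < m) tau i ord0 *
      (dx^T *m (A i - r i *: B i) *m dx) ord0 ord0 =
    (dx^T *m (\sum_(i < m) tau i ord0 *: (A i - r i *: B i)) *m dx) ord0 ord0.
  rewrite mulmx_sumr mulmx_suml summxE; apply: eq_bigr => i _.
  by rewrite -scalemxAr -scalemxAl mxZE.
apply: addr_ge0; last exact: F_psd.
have -> : \sum_(i < m) tau i ord0 *: D i =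
    - \sum_(j < l) lambda j ord0 *: grad (h j) u.
  by apply/eqP; rewrite -addr_eq0; apply/eqP.
have -> : ((- \sum_(j < l) lambda j ord0 *: grad (h j) u)^T *m dx) ord0 ord0 =
    - \sum_(j < l) lambda j ord0 * ((grad (h j) u)^T *m dx) ord0 ord0.
  rewrite linearN /= mulNmx mxE linear_sum /= mulmx_suml summxE; congr (- _).
  by apply: eq_bigr => j _; rewrite linearZ /= -scalemxAl mxZE.
(* Convexity bounds each gradient term, weighted by [lambda j >= 0]; then the weighted sum of
   [h j x] is at most zero and that of [h j u] at least zero. *)
rewrite oppr_ge0; apply: le_trans
  (_ : \sum_(j < l) lambda j ord0 * (h j x - h j u) <= 0).
  apply: ler_sum => j _; rewrite ler_wpM2l // -dxE.
  by have [_] := h_convex j; exact.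
under eq_bigr do rewrite mulrBr.
rewrite sumrB subr_le0; apply: le_trans lhu.
by apply: sumr_le0 => j _; rewrite mulr_ge0_le0.
Qed.
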